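(* For any compact Riemannian manifold $(M^n,g)$ there exists $\delta>0$ such that no open geodesic ball of radius $\delta$ in $M$ contains a compact minimal submanifold of $(M,g)$.
   Context: The open geodesic ball of radius $\delta$ centered at $p\in M$ is the set of points at Riemannian distance less than $\delta$ from $p$. Submanifolds are immersed, connected, of dimension at least one, and compact submanifolds have no boundary; a geodesic ball contains a submanifold if it contains the image of the immersion. A submanifold is minimal if its mean curvature vector field vanishes identically. The submanifold's dimension is smaller than $n$. *)

(* Defs.v *)
From mathcomp Require Import all_boot all_order all_algebra.
From mathcomp Require Import all_classical all_reals all_analysis.

Set Implicit Arguments.
Unset Strict Implicit.
Unset Printing Implicit Defensive.

Import Order.TTheory GRing.Theory Num.Theory numFieldNormedType.Exports.

Local Open Scope classical_set_scope.
Local Open Scope ring_scope.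

(* Meant for an open set U and a finite-dimensional V: the derivative of f is
   then C^k if and only if each of its evaluations 'D_v f is. *)
Fixpoint Ck (R : realType) (V W : normedModType R) (k : nat) (U : set V)
    (f : V -> W) : Prop :=
  if k is k'.+1 then
    (forall x, U x -> differentiable f x) /\
    (forall v : V, Ck k' U (fun x => 'D_v f x))
  else {in U, continuous f}.

Definition smooth_on (R : realType) (V W : normedModType R) (U : set V)
    (f : V -> W) : Prop :=
  forall k, Ck k U f.

(* A homeomorphism from the open set [chart_dom] of M onto the open set
   [chart_cod] of R^n; the values of [chart_coord] outside [chart_dom] and of
   [chart_param] outside [chart_cod] are irrelevant. *)
Record chart (R : realType) (n : nat) (M : topologicalType) := Chart {
  chart_dom : set M;
  chart_cod : set 'rV[R]_n;
  chart_coord : M -> 'rV[R]_n;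
  chart_param : 'rV[R]_n -> M;
  chart_dom_open : open chart_dom;
  chart_cod_open : open chart_cod;
  chart_coord_cod : forall p, chart_dom p -> chart_cod (chart_coord p);
  chart_param_dom : forall x, chart_cod x -> chart_dom (chart_param x);
  chart_coordK : {in chart_dom, cancel chart_coord chart_param};
  chart_paramK : {in chart_cod, cancel chart_param chart_coord};
  chart_coord_continuous : {in chart_dom, continuous chart_coord};
  chart_param_continuous : {in chart_cod, continuous chart_param} }.

(* Manifolds have no boundary and need not be connected. *)
Record smooth_manifold (R : realType) (n : nat) := SmoothManifold {
  carrier :> topologicalType;
  carrier_hausdorff : hausdorff_space carrier;
  carrier_second_countable : @second_countable carrier;
  atlas : set (chart R n carrier);
  atlas_cover : forall p, exists2 c, atlas c & chart_dom c p;
  atlas_compatible : forall c d, atlas c -> atlas d ->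
    smooth_on [set x | chart_cod c x /\ chart_dom d (chart_param c x)]
      (chart_coord d \o chart_param c) }.

Definition chart_at (R : realType) (n : nat) (M : smooth_manifold R n)
    (p : M) : chart R n M :=
  s2val (cid2 (atlas_cover p)).

Definition smooth_map (R : realType) (k n : nat) (N : smooth_manifold R k)
    (M : smooth_manifold R n) (f : N -> M) : Prop :=
  continuous f /\
  forall (c : chart R k N) (d : chart R n M), atlas c -> atlas d ->
    smooth_on [set u | chart_cod c u /\ chart_dom d (f (chart_param c u))]
      (chart_coord d \o f \o chart_param c).

(* [metric c p] is the Gram matrix, at the point p of [chart_dom c], of the
   coordinate frame of the chart c.  Since 'J acts on row vectors, its i-th row
   is the i-th partial derivative, and [metric_change] is the transformation
   law of a covariant 2-tensor. *)
Record riemannian_metric (R : realType) (n : nat) (M : smooth_manifold R n) :=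
  RiemannianMetric {
  metric :> chart R n M -> M -> 'M[R]_n;
  metric_smooth : forall c, atlas c ->
    smooth_on (chart_cod c) (fun x => metric c (chart_param c x));
  metric_symmetric : forall c p, atlas c -> chart_dom c p ->
    (metric c p)^T = metric c p;
  metric_pos : forall c p, atlas c -> chart_dom c p ->
    forall v : 'rV[R]_n, v != 0 -> 0 < (v *m metric c p *m v^T) 0 0;
  metric_change : forall c d p,
    atlas c -> atlas d -> chart_dom c p -> chart_dom d p ->
    let J := 'J (chart_coord d \o chart_param c) (chart_coord c p) in
    metric c p = J *m metric d p *m J^T }.

(* Smoothness on a set J of parameters, typically a closed interval, means
   agreement on J with a curve that is smooth on an open neighbourhood of J. *)
Definition smooth_curve_on (R : realType) (n : nat) (M : smooth_manifold R n)
    (J : set R) (gam : R -> M) : Prop :=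
  exists (O : set R) (eta : R -> M),
    [/\ open O, J `<=` O, {in O, continuous eta},
        (forall d : chart R n M, atlas d ->
           smooth_on [set t | O t /\ chart_dom d (eta t)]
             (chart_coord d \o eta)) &
        {in J, gam =1 eta}].

Definition piecewise_smooth (R : realType) (n : nat) (M : smooth_manifold R n)
    (gam : R -> M) : Prop :=
  exists2 s : seq R, itv_partition 0 1 s &
    forall i, (i < size s)%N ->
      smooth_curve_on `[nth 1 (0 :: s) i, nth 1 s i] gam.

(* By [metric_change], any chart around gam t gives the same value when gam is
   differentiable at t. *)
Definition speed (R : realType) (n : nat) (M : smooth_manifold R n)
    (g : riemannian_metric M) (gam : R -> M) (t : R) : R :=
  let c := chart_at (gam t) in
  let v := derive1 (chart_coord c \o gam) t in
  Num.sqrt ((v *m g c (gam t) *m v^T) 0 0).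

Definition curve_length (R : realType) (n : nat) (M : smooth_manifold R n)
    (g : riemannian_metric M) (gam : R -> M) : \bar R :=
  (\int[lebesgue_measure]_(t in `[0%R, 1%R]) (speed g gam t)%:E)%E.

(* The distance is +oo between distinct connected components. *)
Definition riemannian_distance (R : realType) (n : nat)
    (M : smooth_manifold R n) (g : riemannian_metric M) (p q : M) : \bar R :=
  ereal_inf [set curve_length g gam | gam in
    [set gam : R -> M | [/\ piecewise_smooth gam, gam 0 = p & gam 1 = q]]].

Definition geodesic_ball (R : realType) (n : nat) (M : smooth_manifold R n)
    (g : riemannian_metric M) (p : M) (r : R) : set M :=
  [set q | (riemannian_distance g p q < r%:E)%E].

Definition is_immersion (R : realType) (k n : nat) (N : smooth_manifold R k)
    (M : smooth_manifold R n) (f : N -> M) : Prop :=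
  smooth_map f /\
  forall (c : chart R k N) (d : chart R n M) (q : N),
    atlas c -> atlas d -> chart_dom c q -> chart_dom d (f q) ->
    injective ('d (chart_coord d \o f \o chart_param c) (chart_coord c q)).

Record submanifold (R : realType) (n : nat) (M : smooth_manifold R n) :=
  Submanifold {
  sub_dim : nat;
  sub_dim_gt0 : (0 < sub_dim)%N;
  sub_dim_lt : (sub_dim < n)%N;
  sub_source : smooth_manifold R sub_dim;
  sub_nonempty : [set: sub_source] !=set0;
  sub_connected : connected [set: sub_source];
  sub_incl : sub_source -> M;
  sub_immersion : is_immersion sub_incl }.

Arguments sub_incl {R n M} S q : rename.

(* In this section G is the Gram matrix of a Riemannian metric on an open
   subset of R^n and X a parametrised k-dimensional submanifold of it. *)
Section LocalGeometry.
Variables (R : realType) (k n : nat).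
Variables (G : 'rV[R]_n -> 'M[R]_n) (X : 'rV[R]_k -> 'rV[R]_n).

(* Gamma^l_ij of the Levi-Civita connection *)
Definition christoffel (x : 'rV[R]_n) (l i j : 'I_n) : R :=
  2^-1 * \sum_(m < n) invmx (G x) l m *
    ('D_(delta_mx 0 i) (fun y => G y j m) x
     + 'D_(delta_mx 0 j) (fun y => G y i m) x
     - 'D_(delta_mx 0 m) (fun y => G y i j) x).

Definition first_form (u : 'rV[R]_k) : 'M[R]_k :=
  'J X u *m G (X u) *m ('J X u)^T.

(* covariant derivative, in the ambient space, of the b-th coordinate field of
   X in the direction of the a-th one *)
Definition covariant_deriv (u : 'rV[R]_k) (a b : 'I_k) : 'rV[R]_n :=
  'D_(delta_mx 0 a) (fun w => 'D_(delta_mx 0 b) X w) u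
  + \row_l \sum_(i < n) \sum_(j < n)
      christoffel (X u) l i j * 'J X u a i * 'J X u b j.

(* component of v orthogonal, for G (X u), to the rows of 'J X u *)
Definition normal_part (u : 'rV[R]_k) (v : 'rV[R]_n) : 'rV[R]_n :=
  v - v *m G (X u) *m ('J X u)^T *m invmx (first_form u) *m 'J X u.

Definition second_form (u : 'rV[R]_k) (a b : 'I_k) : 'rV[R]_n :=
  normal_part u (covariant_deriv u a b).

(* The trace is not divided by k. *)
Definition mean_curvature (u : 'rV[R]_k) : 'rV[R]_n :=
  \sum_(a < k) \sum_(b < k) invmx (first_form u) a b *: second_form u a b.

End LocalGeometry.

(* Components, in the chart d of M, of the mean curvature vector of f at q,
   computed in the chart c of N. *)
Definition mean_curvature_vector (R : realType) (k n : nat)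
    (N : smooth_manifold R k) (M : smooth_manifold R n)
    (g : riemannian_metric M) (f : N -> M)
    (c : chart R k N) (d : chart R n M) (q : N) : 'rV[R]_n :=
  mean_curvature (fun x => g d (chart_param d x))
    (chart_coord d \o f \o chart_param c) (chart_coord c q).

Definition minimal_submanifold (R : realType) (n : nat)
    (M : smooth_manifold R n) (g : riemannian_metric M)
    (S : submanifold M) : Prop :=
  forall (c : chart R (sub_dim S) (sub_source S)) (d : chart R n M)
    (q : sub_source S),
    atlas c -> atlas d -> chart_dom c q -> chart_dom d (sub_incl S q) ->
    mean_curvature_vector g (sub_incl S) c d q = 0.

(* Main.v *)
(* Around a point p0 with coordinates x0, the function |x - x0|^2 of a chart
   has positive definite Riemannian Hessian on a neighbourhood U of p0.  On a
   compact submanifold lying in U this function attains its maximum, where the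
   trace of its second derivatives for the induced metric is nonpositive; but
   for a minimal submanifold that trace is the trace of the ambient Hessian on
   the tangent space, which is positive.  Hence U contains no compact minimal
   submanifold.

   A C^1 bump function F supported in U and with gradient of norm at most 1
   satisfies F p - F q <= dist p q.  It shows that all balls of radius
   F p0 / 2 whose centre is close to p0 are contained in U, and compactness of
   M makes the radius uniform. *)
Require Import Defs.
From mathcomp Require Import all_boot all_order all_algebra.
From mathcomp Require Import ring lra.
From mathcomp Require Import all_classical all_reals all_analysis.
From mathcomp Require Import measurable_realfun.
Set Implicit Arguments.
Unset Strict Implicit.
Unset Printing Implicit Defensive.
Import Order.TTheory GRing.Theory Num.Theory numFieldNormedType.Exports.
Local Open Scope classical_set_scope.
Local Open Scope ring_scope.

(** * Quadratic forms and positive definite matrices *)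

Definition quad (R : pzRingType) (k : nat) (A : 'M[R]_k) (v : 'rV[R]_k) : R :=
  (v *m A *m v^T) 0 0.

Lemma quadE (R : comPzRingType) k (A : 'M[R]_k) v :
  quad A v = \sum_i \sum_j A i j * (v 0 i * v 0 j).
Proof.
rewrite /quad mxE exchange_big; apply: eq_bigr => j _.
by rewrite !mxE mulr_suml; apply: eq_bigr => i _; rewrite mulrCA mulrA.
Qed.

(** [quad 1%:M] is the squared Euclidean norm. It is used beside the norm of ['rV[R]_k], which is
    the maximum norm and is not smooth. *)
Lemma quad1E (R : comPzRingType) k (v : 'rV[R]_k) :
  quad 1%:M v = \sum_i v 0 i ^+ 2.
Proof.
by rewrite /quad mulmx1 mxE; apply: eq_bigr => i _; rewrite mxE expr2.
Qed.

Lemma quad1_ge0 (R : realDomainType) k (v : 'rV[R]_k) : 0 <= quad 1%:M v.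
Proof. by rewrite quad1E; apply: sumr_ge0 => i _; exact: sqr_ge0. Qed.

Lemma sqr_le_quad1 (R : realDomainType) k (v : 'rV[R]_k) i :
  v 0 i ^+ 2 <= quad 1%:M v.
Proof.
by rewrite quad1E (bigD1 i)//= lerDl; apply: sumr_ge0 => j _; exact: sqr_ge0.
Qed.

Lemma quad1_gt0 (R : realDomainType) k (v : 'rV[R]_k) :
  v != 0 -> 0 < quad 1%:M v.
Proof.
move=> v0; have [i vi0] : exists i, v 0 i != 0.
  apply/existsP; apply: contraNT v0 => /existsPn v0.
  by apply/eqP/rowP => i; rewrite mxE; apply/eqP/negPn/v0.
by apply: lt_le_trans (sqr_le_quad1 v i); rewrite exprn_even_gt0.
Qed.

Lemma quadB (R : comPzRingType) k (A B : 'M[R]_k) v :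
  quad (A - B) v = quad A v - quad B v.
Proof. by rewrite /quad mulmxBr mulmxBl !mxE. Qed.

Lemma quad_mul (R : comPzRingType) k l (A : 'M[R]_k) (B : 'M[R]_(l, k)) v :
  quad (B *m A *m B^T) v = quad A (v *m B).
Proof. by rewrite /quad trmx_mul !mulmxA. Qed.

Lemma quad_norm_le (R : realFieldType) k (A : 'M[R]_k) v :
  `|quad A v| <= (\sum_i \sum_j `|A i j|) * quad 1%:M v.
Proof.
rewrite quadE mulr_suml; apply: le_trans (ler_norm_sum _ _ _) _.
apply: ler_sum => i _; rewrite mulr_suml.
apply: le_trans (ler_norm_sum _ _ _) _; apply: ler_sum => j _.
rewrite normrM ler_wpM2l//.
have := sqr_le_quad1 v i; have := sqr_le_quad1 v j.
(* The two squares give $|v_i v_j| \le (v_i^2 + v_j^2)/2$. *)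
have := sqr_ge0 (v 0 i - v 0 j); have := sqr_ge0 (v 0 i + v 0 j).
rewrite !expr2 ler_norml => *; apply/andP; split; lra.
Qed.

Definition posdef (R : numDomainType) k (A : 'M[R]_k) :=
  forall v, v != 0 -> 0 < quad A v.

(** Induction on the size: one elimination step splits off the pivot [a], and the remaining block,
    the Schur complement, is again symmetric and positive definite. The rows of [B] form an
    orthonormal basis for the form [A]. *)
Lemma posdef_congr1 (R : rcfType) k (A : 'M[R]_k) :
  A^T = A -> posdef A -> exists B : 'M[R]_k, B *m A *m B^T = 1%:M.
Proof.
elim: k A => [|k IHk] A symA posA.
  by exists 0; apply/matrixP => -[].
move: A symA posA; rewrite -[k.+1]/(1 + k)%N => A symA posA.
pose a := ulsubmx A 0 0; pose b := ursubmx A; pose D := drsubmx A.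
have ulA : ulsubmx A = a%:M by rewrite [LHS]mx11_scalar.
have AE : A = block_mx a%:M b b^T D.
  by rewrite -ulA -{1}(submxK A) trmx_ursub symA.
have a_gt0 : 0 < a.
  have e0 : row_mx (1 : 'rV[R]_1) (0 : 'rV[R]_k) != 0.
    by apply/eqP => /rowP/(_ (lshift k 0)); rewrite row_mxEl !mxE => /eqP;
       rewrite oner_eq0.
  have := posA _ e0; rewrite /quad AE mul_row_block tr_row_mx mul_row_col.
  by rewrite !mul0mx !addr0 !trmx0 mulmx0 addr0 mul1mx trmx1 mulmx1 mxE mulr1n.
(* Symmetric elimination of the first row and column. *)
pose L : 'M[R]_(1 + k) := block_mx 1%:M 0 (- a^-1 *: b^T) 1%:M.
have LAL : L *m A *m L^T = block_mx a%:M 0 0 (D - a^-1 *: (b^T *m b)).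
  rewrite AE /L tr_block_mx !trmx1 trmx0 !linearZ/= trmxK !mulmx_block.
  rewrite !mul1mx !mul0mx !addr0 !mulmx1 !mulmx0 ?addr0.
  rewrite mul_mx_scalar mul_scalar_mx -!scalemxAl scalerA scalerA.
  have a1 : a * - a^-1 = -1 by rewrite mulrN divff// gt_eqF.
  by rewrite a1 !scaleN1r !addNr mul0mx add0r scaleNr scalerN [- _ + _]addrC.
have L_free v : v *m L = 0 -> v = 0.
  have /mulmx1C LLi :
      (block_mx 1%:M 0 (a^-1 *: b^T) 1%:M : 'M[R]_(1 + k)) *m L = 1%:M.
    rewrite /L mulmx_block !mul1mx !mul0mx !mulmx0 !mulmx1 !addr0 !add0r.
    by rewrite scaleNr subrr -scalar_mx_block.
  by move=> /(congr1 (mulmx^~ (block_mx 1%:M 0 (a^-1 *: b^T) 1%:M)));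
     rewrite -mulmxA LLi mulmx1 mul0mx.
have [||C CD] := IHk (D - a^-1 *: (b^T *m b)).
- have symD : D^T = D by rewrite trmx_drsub symA.
  by rewrite linearB linearZ/= trmx_mul trmxK symD.
(* The Schur complement takes at [w] the value of [A] at [row_mx 0 w *m L], which is nonzero because
   [L] is invertible. *)
- move=> w w0; have : row_mx (0 : 'rV[R]_1) w *m L != 0.
    apply: contraNneq w0 => /L_free /(congr1 rsubmx).
    by rewrite row_mxKr => ->; rewrite linear0.
  move=> /posA; rewrite -quad_mul LAL /quad mul_row_block !mul0mx !mulmx0.
  by rewrite !add0r tr_row_mx mul_row_col trmx0 mul0mx add0r.
exists (block_mx (Num.sqrt a)^-1%:M 0 0 C *m L).
rewrite trmx_mul -!mulmxA (mulmxA A) (mulmxA L) (mulmxA L A) LAL tr_block_mx.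
rewrite !mulmx_block !trmx0 !(mul0mx, mulmx0, addr0, add0r) !mulmxA CD.
rewrite tr_scalar_mx -!scalar_mxM scalar_mx_block; congr (block_mx _%:M _ _ _).
have sa : Num.sqrt a != 0 by rewrite gt_eqF// sqrtr_gt0.
by rewrite -[X in _ * X / _]sqr_sqrtr ?ltW//; field.
Qed.

Lemma posdef_unitmx (R : rcfType) k (A : 'M[R]_k) :
  A^T = A -> posdef A -> A \in unitmx.
Proof.
move=> symA /(posdef_congr1 symA)[B].
by rewrite -mulmxA => /mulmx1C/mulmx1_unit[]; rewrite unitmx_mul => /andP[].
Qed.

(** Writing [invmx h = B^T *m B] turns the trace of [Q] with respect to [h] into the sum of the
    values of [Q] on the rows of [B], an orthonormal basis for [h]. *)
Lemma posdef_tr_invmx_gt0 (R : rcfType) k (h Q : 'M[R]_k) : (0 < k)%N ->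
  h^T = h -> posdef h -> posdef Q ->
  0 < \sum_a \sum_b invmx h a b * Q a b.
Proof.
move=> k0 symh posh posQ; have [B BhB] := posdef_congr1 symh posh.
have uh := posdef_unitmx symh posh.
have uB : B \in unitmx by move: BhB; rewrite -mulmxA => /mulmx1_unit[].
have hE : invmx h = B^T *m B.
  have /mulmx1C : B *m (h *m B^T) = 1%:M by rewrite mulmxA.
  by rewrite -mulmxA => /(congr1 (mulmx (invmx h))); rewrite mulKmx// mulmx1.
have -> : \sum_a \sum_b invmx h a b * Q a b = \sum_i quad Q (row i B).
  under [RHS]eq_bigr do rewrite quadE.
  rewrite [RHS]exchange_big/=; apply: eq_bigr => a _.
  rewrite [RHS]exchange_big/=; apply: eq_bigr => b _.
  rewrite hE mxE mulr_suml; apply: eq_bigr => i _.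
  by rewrite !mxE mulrC.
have rowB0 i : 0 < quad Q (row i B).
  apply: posQ; apply/eqP => /(congr1 (mulmx^~ (invmx B))).
  rewrite -row_mul mulmxV// mul0mx => /rowP/(_ i).
  by rewrite !mxE eqxx => /eqP; rewrite oner_eq0.
rewrite (bigD1 (Ordinal k0))//= ltr_pwDl//.
by apply: sumr_ge0 => i _; exact: ltW.
Qed.

(** * Limits of determinants, inverses and positive definite matrices *)

Lemma cvg_sumr (R : realType) (T I : Type) (F : set_system T) (r : seq I)
    (P : pred I) (f : I -> T -> R) (l : I -> R) : Filter F ->
  (forall i, P i -> f i x @[x --> F] --> l i) ->
  \sum_(i <- r | P i) f i x @[x --> F] --> \sum_(i <- r | P i) l i.
Proof. by move=> FF; apply: cvg_big => //; exact: add_continuous. Qed.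

Lemma cvg_prodr (R : realType) (T I : Type) (F : set_system T) (r : seq I)
    (P : pred I) (f : I -> T -> R) (l : I -> R) : Filter F ->
  (forall i, P i -> f i x @[x --> F] --> l i) ->
  \prod_(i <- r | P i) f i x @[x --> F] --> \prod_(i <- r | P i) l i.
Proof. by move=> FF; apply: cvg_big => //; exact: mul_continuous. Qed.

Lemma cvg_det (R : realType) (T : Type) (F : set_system T) n
    (A : T -> 'M[R]_n) (A0 : 'M[R]_n) : Filter F ->
  (forall i j, A x i j @[x --> F] --> A0 i j) ->
  \det (A x) @[x --> F] --> \det A0.
Proof.
move=> FF AA0; apply: cvg_sumr => s _; apply: cvgM; first exact: cvg_cst.
by apply: cvg_prodr => i _; exact: AA0.
Qed.

Lemma cvg_invmx (R : realType) (T : Type) (F : set_system T) n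
    (A : T -> 'M[R]_n) (A0 : 'M[R]_n) : Filter F -> A0 \in unitmx ->
  (forall i j, A x i j @[x --> F] --> A0 i j) ->
  forall i j, invmx (A x) i j @[x --> F] --> invmx A0 i j.
Proof.
move=> FF uA0 AA0 i j.
have d0 : \det A0 != 0 by move: uA0; rewrite unitmxE unitfE.
have detA := cvg_det FF AA0.
have -> : invmx A0 i j = (\det A0)^-1 * cofactor A0 j i.
  by rewrite /invmx uA0 !mxE.
have : (\det (A x))^-1 * cofactor (A x) j i @[x --> F] -->
    (\det A0)^-1 * cofactor A0 j i.
  apply: cvgM; first exact: cvgV.
  apply: cvgM; first exact: cvg_cst.
  apply: cvg_det => a b.
  by rewrite !mxE; under eq_fun do rewrite !mxE; exact: AA0.
apply: cvg_trans; apply: near_eq_cvg.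
(* [invmx] returns a singular matrix unchanged, so the cofactor formula is available only where the
   determinant is nonzero, which holds eventually along [F]. *)
have : \forall x \near F, \det (A x) != 0.
  by apply: cvgr_neq0 detA _.
apply: filterS => x dx.
by rewrite /invmx unitmxE unitfE dx !mxE.
Qed.

(** The congruence at [x0] provides a lower bound there. Half of it is given up to absorb the form
    of [A x - A x0], which is bounded by the sum of the absolute values of its entries. *)
Lemma posdef_near (R : realType) (T : topologicalType) n (A : T -> 'M[R]_n)
    (x0 : T) :
  (forall i j, A x i j @[x --> x0] --> A x0 i j) ->
  (A x0)^T = A x0 -> posdef (A x0) ->
  exists2 c : R, 0 < c &
    \forall x \near x0, forall v, c * quad 1%:M v <= quad (A x) v.
Proof.
move=> cA symA posA; have [B BAB] := posdef_congr1 symA posA.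
have uB : B \in unitmx by move: BAB; rewrite -mulmxA => /mulmx1_unit[].
(* [C] bounds the form of [B *m B^T]; the [+ 1] makes it positive even in dimension 0. *)
pose C := \sum_i \sum_j `|(B *m 1%:M *m B^T) i j| + 1.
have C_gt0 : 0 < C.
  by rewrite ltr_wpDl//; do 2 (apply: sumr_ge0 => ? _).
have le0 v : C^-1 * quad 1%:M v <= quad (A x0) v.
  rewrite ler_pdivrMl//.
  have : v = (v *m invmx B) *m B by rewrite mulmxKV.
  move: (v *m invmx B) => u ->.
  rewrite -!quad_mul BAB.
  apply: le_trans (ler_norm _) _; apply: le_trans (quad_norm_le _ _) _.
  by rewrite ler_wpM2r ?quad1_ge0// lerDl.
exists (C^-1 / 2); first by rewrite divr_gt0// invr_gt0.
have : \sum_i \sum_j `|(A x - A x0) i j| @[x --> x0] -->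
    \sum_(i < n) \sum_(j < n) `|(A x0 - A x0) i j|.
  apply: cvg_sumr => i _; apply: cvg_sumr => j _; apply: cvg_norm.
  rewrite !mxE; under eq_fun do rewrite !mxE.
  by apply: cvgB; [exact: cA|exact: cvg_cst].
rewrite big1 => [|i _]; last first.
  by rewrite big1// => j _; rewrite subrr mxE normr0.
have C2 : 0 < C^-1 / 2 by rewrite divr_gt0// invr_gt0.
move=> /cvgr_lt/(_ _ C2); apply: filterS => x Ax v.
have -> : quad (A x) v = quad (A x0) v + quad (A x - A x0) v.
  by rewrite quadB addrC subrK.
have := quad_norm_le (A x - A x0) v; rewrite ler_norml => /andP[+ _].
have := ler_wpM2r (quad1_ge0 v) (ltW Ax); have := le0 v.
set S := \sum_i _; lra.
Qed.

(** * Derivatives along lines and second-order conditions at a maximum *)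

Lemma is_derive_line (R : realType) (V W : normedModType R) (f : V -> W)
    (x w : V) (t : R) : derivable f (t *: w + x) w ->
  is_derive t 1 (fun s => f (s *: w + x)) ('D_w f (t *: w + x)).
Proof.
have E : (fun h : R => h^-1 *: (f ((h *: 1 + t) *: w + x) - f (t *: w + x))) =
    (fun h => h^-1 *: (f (h *: w + (t *: w + x)) - f (t *: w + x))).
  by apply/funext => h; rewrite [h *: 1]mulr1 scalerDl addrA.
move=> df; apply: DeriveDef.
  by rewrite /derivable /= E.
by rewrite /derive /= E.
Qed.

(** If [d] were positive, [df] would be positive just to the right of its zero at 0, and by the mean
    value theorem [f] would exceed [f 0] there. *)
Lemma second_derive_le0_at_max (R : realType) (f df : R -> R) (d : R) :
  (\forall t \near (0 : R), is_derive t (1 : R) f (df t)) ->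
  is_derive (0 : R) (1 : R) df d -> (\forall t \near (0 : R), f t <= f 0) ->
  df 0 = 0 /\ d <= 0.
Proof.
move=> fdf dfd fmax.
have [e /= e0 he] : exists2 e : R, 0 < e & forall t, `|t| < e ->
    is_derive t (1 : R) f (df t) /\ f t <= f 0.
  have : \forall t \near (0 : R), is_derive t (1 : R) f (df t) /\ f t <= f 0.
    by near do split.
  move=> /nbhs_ballP[e /= e0 he]; exists e => // t te; apply: he.
  by rewrite /ball/= sub0r normrN.
have df0 : df 0 = 0.
  have : is_derive (0 : R) (1 : R) f 0.
    apply: (@derive1_at_max _ f (- e) e 0).
    - lra.
    - move=> t; rewrite in_itv/= => /andP[t1 t2].
      by have [|[]] := he t; first by rewrite ltr_norml t1.
    - by rewrite in_itv/= e0 oppr_lt0 e0.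
    - move=> t; rewrite in_itv/= => /andP[t1 t2].
      by have [|] := he t; first by rewrite ltr_norml t1.
  have [|/@derive_val <- _] := he 0; first by rewrite normr0.
  by move=> /@derive_val.
split=> //; rewrite leNgt; apply/negP => d0.
have [_ dE] := dfd.
have : (fun h : R => h^-1 *: (df (h *: 1 + 0) - df 0)) @ 0^' --> d.
  by rewrite -dE; case: dfd.
move=> /cvgr_gt/(_ 0 d0) [r /= r0 hr].
pose s := Num.min e r / 2.
have s0 : 0 < s by rewrite divr_gt0// lt_min e0.
have [se sr] : s < e /\ s < r.
  have : s < Num.min e r.
    by rewrite ltr_pdivrMr// mulr2n mulrDr !mulr1 ltrDl lt_min e0.
  by rewrite lt_min => /andP.
have [||c] := @MVT _ f df 0 s s0.
- move=> t; rewrite in_itv/= => /andP[t1 t2].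
  by have [] := he t; rewrite // gtr0_norm// (lt_trans t2).
- apply: derivable_within_continuous => t; rewrite in_itv/= => /andP[t1 t2].
  by have [|[]] := he t; rewrite // ger0_norm// (le_lt_trans t2).
rewrite in_itv/= => /andP[c0 cs] fE.
have [|_ fs] := he s; first by rewrite gtr0_norm.
have dfc : 0 < df c.
  have := hr c; rewrite /= sub0r normrN gtr0_norm// (lt_trans cs sr) gt_eqF//.
  move=> /(_ isT isT); rewrite df0 subr0 [c *: 1]mulr1 addr0.
  by rewrite -[_ *: _]/(c^-1 * df c) pmulr_rgt0// invr_gt0.
have : 0 < f s - f 0 by rewrite fE mulr_gt0// subr0.
by rewrite subr_gt0 ltNge fs.
Unshelve. all: by end_near. Qed.
Lemma is_derive_coord (R : realType) (V : normedModType R) m n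
    (F : V -> 'M[R]_(m, n)) (x v : V) (dF : 'M[R]_(m, n)) i j :
  is_derive x v F dF -> is_derive x v (fun y => F y i j) (dF i j).
Proof.
move=> [dFx <-]; apply: DeriveDef; first by move/derivable_mxP : dFx; apply.
by rewrite derive_mx// mxE.
Qed.

Lemma derive_sum_delta (R : realType) (W : normedModType R) k
    (f : 'rV[R]_k -> W) (x w : 'rV[R]_k) : differentiable f x ->
  'D_w f x = \sum_a w 0 a *: 'D_(delta_mx 0 a) f x.
Proof.
move=> df; rewrite deriveE// [in LHS](row_sum_delta w) linear_sum.
by apply: eq_bigr => a _; rewrite linearZ deriveE.
Qed.

Lemma line_cvg (R : realType) (V : normedModType R) (x w : V) :
  t *: w + x @[t --> (0 : R)] --> x.
Proof.
rewrite -[X in _ --> X]add0r -(scale0r w).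
by apply: cvgD; [apply: cvgZr_tmp; exact: cvg_id|exact: cvg_cst].
Qed.

Lemma is_derive_sumr (R : realType) n (f : 'I_n -> R -> R) (df : 'I_n -> R)
    (t : R) : (forall l, is_derive t (1 : R) (f l) (df l)) ->
  is_derive t (1 : R) (fun s => \sum_l f l s) (\sum_l df l).
Proof. by move=> fdf; rewrite -fct_sumE; exact: is_derive_sum. Qed.

Lemma is_deriveMr (R : realType) (f g : R -> R) (df dg t : R) :
  is_derive t (1 : R) f df -> is_derive t (1 : R) g dg ->
  is_derive t (1 : R) (fun s => f s * g s) (f t * dg + df * g t).
Proof. by move=> fdf gdg; rewrite [df * _]mulrC; exact: is_deriveM. Qed.

Lemma is_derive_quad1 (R : realType) n (x : R -> 'rV[R]_n) (dx x0 : 'rV[R]_n)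
    (t : R) : is_derive t (1 : R) x dx ->
  is_derive t (1 : R) (fun s => quad 1%:M (x s - x0))
    (2 * \sum_l (x t 0 l - x0 0 l) * dx 0 l).
Proof.
move=> xdx.
have -> : (fun s => quad 1%:M (x s - x0)) =
    (fun s => \sum_l (x s 0 l - x0 0 l) * (x s 0 l - x0 0 l)).
  by apply/funext => s; rewrite quad1E; apply: eq_bigr => l _;
     rewrite expr2 !mxE.
have -> : 2 * \sum_l (x t 0 l - x0 0 l) * dx 0 l =
    \sum_l ((x t 0 l - x0 0 l) * dx 0 l + dx 0 l * (x t 0 l - x0 0 l)).
  rewrite mulr_sumr; apply: eq_bigr => l _.
  by rewrite [dx _ _ * _]mulrC -mulr2n mulr_natl.
have dxl l : is_derive t (1 : R) (fun s => x s 0 l - x0 0 l) (dx 0 l).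
  by rewrite -[dx 0 l]subr0; apply: is_deriveB; exact: is_derive_coord.
by apply: is_derive_sumr => l; exact: is_deriveMr.
Qed.

(** The two left-hand sides are half the first and second derivatives at 0 of the squared Euclidean
    distance to [x0] along [X (t *: w + u)], so the one-variable conditions apply. *)
Lemma distance_max_derive (R : realType) k n (D : set 'rV[R]_k)
    (X : 'rV[R]_k -> 'rV[R]_n) (u : 'rV[R]_k) (x0 : 'rV[R]_n) :
  open D -> D u -> Ck 2 D X ->
  (forall v, D v -> quad 1%:M (X v - x0) <= quad 1%:M (X u - x0)) ->
  forall w, ('D_w X u *m (X u - x0)^T) 0 0 = 0 /\
    ('D_w (fun v => 'D_w X v) u *m (X u - x0)^T) 0 0
      + quad 1%:M ('D_w X u) <= 0.
Proof.
move=> oD Du [dX ddX] maxu w; have [dwX _] := ddX w.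
pose Y l t := X (t *: w + u) 0 l - x0 0 l.
pose dY l t := ('D_w X (t *: w + u)) 0 l.
pose ddY l := ('D_w (fun v => 'D_w X v) u) 0 l.
have nearD : \forall t \near (0 : R), D (t *: w + u).
  by apply: (@line_cvg _ _ u w); exact: open_nbhs_nbhs.
have YdY l t : D (t *: w + u) -> is_derive t (1 : R) (Y l) (dY l t).
  move=> Dt; rewrite -[dY l t]subr0; apply: is_deriveB.
  by apply: is_derive_coord; apply/is_derive_line/diff_derivable/dX.
have dYddY l : is_derive (0 : R) (1 : R) (dY l) (ddY l).
  have D0 : D (0 *: w + u) by rewrite scale0r add0r.
  have := is_derive_coord 0 l (is_derive_line (diff_derivable (dwX _ D0))).
  by rewrite scale0r add0r.
pose f t := quad 1%:M (X (t *: w + u) - x0).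
pose df t : R := 2 * \sum_l Y l t * dY l t.
pose d : R := 2 * \sum_l (Y l 0 * ddY l + dY l 0 * dY l 0).
have fdf : \forall t \near (0 : R), is_derive t (1 : R) f (df t).
  near=> t; apply: is_derive_quad1; apply/is_derive_line/diff_derivable/dX.
  by near: t; exact: nearD.
have dfd : is_derive (0 : R) (1 : R) df d.
  apply: is_deriveZ; apply: is_derive_sumr => l.
  have YdY0 : is_derive (0 : R) (1 : R) (Y l) (dY l 0).
    by apply: YdY; rewrite scale0r add0r.
  exact: is_deriveMr.
have fmax : \forall t \near (0 : R), f t <= f 0.
  near=> t; rewrite /f scale0r add0r; apply: maxu; near: t; exact: nearD.
have [df0 d0] := second_derive_le0_at_max fdf dfd fmax.
have X0 l : Y l 0 = (X u - x0) 0 l by rewrite /Y scale0r add0r !mxE.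
have dX0 l : dY l 0 = ('D_w X u) 0 l by rewrite /dY scale0r add0r.
have two0 : (0 : R) < 2 by [].
split.
  move/eqP : df0; rewrite mulf_eq0 pnatr_eq0/= => /eqP df0.
  rewrite mxE -[RHS]df0; apply: eq_bigr => l _.
  by rewrite !mxE X0 dX0 mulrC !mxE.
move: d0; rewrite pmulr_rle0//; apply: le_trans.
rewrite quad1E mxE -big_split/=; apply: ler_sum => l _.
by rewrite X0 dX0 !mxE expr2 mulrC.
Unshelve. all: by end_near. Qed.

(** * Hessian of the squared coordinate distance, and mean curvature *)

(* Hessian, for the metric G, of half the Euclidean squared distance to x0 in
   the coordinates of the chart. *)
Definition distance_hessian (R : realType) n (G : 'rV[R]_n -> 'M[R]_n)
    (x0 x : 'rV[R]_n) : 'M[R]_n :=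
  1%:M - \matrix_(i, j) \sum_l christoffel G x l i j * (x - x0) 0 l.

Lemma derive2_sum_delta (R : realType) (W : normedModType R) k
    (D : set 'rV[R]_k) (X : 'rV[R]_k -> W) (u w : 'rV[R]_k) :
  open D -> D u -> Ck 2 D X ->
  'D_w (fun v => 'D_w X v) u =
  \sum_a \sum_b (w 0 a * w 0 b) *:
    'D_(delta_mx 0 a) (fun v => 'D_(delta_mx 0 b) X v) u.
Proof.
move=> oD Du [dX ddX].
have -> : 'D_w (fun v => 'D_w X v) u =
    'D_w (\sum_b (w 0 b *: (fun v => 'D_(delta_mx 0 b) X v))) u.
  apply: near_eq_derive; near=> v.
  rewrite fct_sumE; apply: derive_sum_delta; apply: dX; near: v.
  exact: open_nbhs_nbhs.
have dDX b : differentiable (fun v => 'D_(delta_mx 0 b) X v) u.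
  by have [+ _] := ddX (delta_mx 0 b); apply.
rewrite derive_sum => [|b]; last exact/derivableZ/diff_derivable.
rewrite exchange_big/=; apply: eq_bigr => b _.
rewrite deriveZ; last exact: diff_derivable.
rewrite derive_sum_delta// scaler_sumr; apply: eq_bigr => a _.
by rewrite scalerA mulrC.
Unshelve. all: by end_near. Qed.

(** Everything is paired with the covector [y], the differential at [X u] of half the squared
    distance. At a maximum [y] kills the tangent space, so pairing the mean curvature with [y]
    leaves the trace of the ambient covariant derivatives, which positivity of the Hessian makes
    negative. *)
Lemma mean_curvature_distance_max (R : realType) k n
    (G : 'rV[R]_n -> 'M[R]_n) (D : set 'rV[R]_k)
    (X : 'rV[R]_k -> 'rV[R]_n) (u : 'rV[R]_k) (x0 : 'rV[R]_n) :
  (0 < k)%N -> open D -> D u -> Ck 2 D X ->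
  (forall v, D v -> quad 1%:M (X v - x0) <= quad 1%:M (X u - x0)) ->
  (G (X u))^T = G (X u) -> posdef (G (X u)) ->
  (forall w : 'rV[R]_k, w != 0 -> w *m 'J X u != 0) ->
  posdef (distance_hessian G x0 (X u)) ->
  mean_curvature G X u != 0.
Proof.
move=> k0 oD Du CX maxu symG posG injJ posH; apply/eqP => H0.
have maxD := distance_max_derive oD Du CX maxu.
have dX : differentiable X u by case: CX => + _; apply.
set y := X u - x0 in maxD; set J := 'J X u in injJ.
(* First-order condition: [y] annihilates the tangent vectors, which are the rows of [J]. *)
have Jy : J *m y^T = 0.
  apply/row_matrixP => a; rewrite row_mul rowE -deriveEjacobian// row0.
  by apply/matrixP => i j; rewrite !ord1 (maxD _).1 mxE.
(* The Hessian at [X u] is the identity minus [K]. *)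
pose K : 'M[R]_n :=
  \matrix_(i, j) \sum_l christoffel G (X u) l i j * y 0 l.
pose N : 'M[R]_k := \matrix_(a, b)
  ('D_(delta_mx 0 a) (fun v => 'D_(delta_mx 0 b) X v) u *m y^T) 0 0.
pose E : 'M[R]_k := - (N + J *m K *m J^T).
have covE a b : (covariant_deriv G X u a b *m y^T) 0 0 = - E a b.
  rewrite mulmxDl mxE !mxE opprK; congr (_ + _).
  under eq_bigr do rewrite !mxE mulr_suml.
  under [RHS]eq_bigr do rewrite [J^T _ _]mxE [(J *m K) _ _]mxE mulr_suml.
  rewrite exchange_big [RHS]exchange_big/=; apply: eq_bigr => i _.
  under eq_bigr do rewrite mulr_suml.
  rewrite exchange_big/=; apply: eq_bigr => j _.
  rewrite [K i j]mxE mulr_sumr mulr_suml; apply: eq_bigr => l _.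
  rewrite !mxE -/J; ring.
(* By the second-order condition, [quad E w] is at least the value of the Hessian at the tangent
   vector [w *m J], which is nonzero by [injJ]. *)
have posE : posdef E.
  move=> w w0; have [_ le0] := maxD w.
  have -> : quad E w = - (('D_w (fun v => 'D_w X v) u *m y^T) 0 0)
      - quad K (w *m J).
    rewrite /quad mulmxN mulNmx mxE mulmxDr mulmxDl mxE -/(quad _ _) opprD.
    rewrite -quad_mul; congr (- _ - _).
    rewrite -/(quad N w) quadE (derive2_sum_delta w oD Du CX).
    rewrite mulmx_suml summxE; apply: eq_bigr => a _.
    rewrite mulmx_suml summxE; apply: eq_bigr => b _.
    by rewrite -scalemxAl [RHS]mxE [N a b]mxE mulrC.
  have := posH _ (injJ _ w0).
  rewrite /distance_hessian quadB -/K.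
  by rewrite -(deriveEjacobian w dX); lra.
have symh : (first_form G X u)^T = first_form G X u.
  by rewrite /first_form !trmx_mul trmxK symG mulmxA.
have posh : posdef (first_form G X u).
  by move=> w w0; rewrite /first_form quad_mul; apply/posG/injJ.
have := posdef_tr_invmx_gt0 k0 symh posh posE.
(* The positive trace of [E] is minus the pairing of the mean curvature with [y], and [H0] makes
   that pairing zero. *)
suff -> : \sum_a \sum_b invmx (first_form G X u) a b * E a b =
    - (mean_curvature G X u *m y^T) 0 0 by rewrite H0 mul0mx mxE oppr0 ltxx.
rewrite mulmx_suml summxE -sumrN; apply: eq_bigr => a _.
rewrite mulmx_suml summxE -sumrN; apply: eq_bigr => b _.
rewrite -scalemxAl [in RHS]mxE -mulrN; congr (_ * _).
(* The tangential part is annihilated by y, since J y = 0. *)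
rewrite /second_form /normal_part mulmxBl -[X in _ - X]mulmxA -/J Jy mulmx0.
by rewrite subr0 covE opprK.
Qed.
(** The Christoffel term carries the factor [x - x0], so the Hessian at [x0] is the identity matrix.
    Its entries are continuous at [x0] because [G] is C^1, and positive definiteness persists
    nearby. *)
Lemma distance_hessian_near (R : realType) n (G : 'rV[R]_n -> 'M[R]_n)
    (V : set 'rV[R]_n) (x0 : 'rV[R]_n) :
  open V -> V x0 -> Ck 1 V G -> (G x0)^T = G x0 -> posdef (G x0) ->
  \forall x \near x0, posdef (distance_hessian G x0 x).
Proof.
move=> oV Vx0 [dG cDG] symG posG.
have uG := posdef_unitmx symG posG.
have VE : \forall x \near x0, V x by exact: open_nbhs_nbhs.
have cG i j : G x i j @[x --> x0] --> G x0 i j.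
  apply: (@cvg_comp _ _ _ G (fun A => A i j) _ (nbhs (G x0))).
    exact: differentiable_continuous (dG _ Vx0).
  exact: coord_continuous.
have cD v i j :
    'D_v (fun y => G y i j) x @[x --> x0] --> 'D_v (fun y => G y i j) x0.
  have DE x : V x -> ('D_v G x) i j = 'D_v (fun y => G y i j) x.
    by move=> Vx; rewrite derive_mx ?mxE//; exact/diff_derivable/dG.
  have : ('D_v G x) i j @[x --> x0] --> ('D_v G x0) i j.
    apply: (@cvg_comp _ _ _ ('D_v G) (fun A => A i j) _ (nbhs ('D_v G x0))).
      by apply: cDG; rewrite inE.
    exact: coord_continuous.
  rewrite -DE//; apply: cvg_trans; apply: (near_eq_cvg (F := nbhs x0)).
  by near=> x; apply: DE; near: x.
have cchr l i j :
    christoffel G x l i j @[x --> x0] --> christoffel G x0 l i j.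
  rewrite /christoffel.
  apply: (@cvgM _ _ (nbhs x0) _ (fun=> 2^-1)); first exact: cvg_cst.
  apply: (@cvg_sumr _ _ _ (nbhs x0)) => m _; apply: cvgM.
    exact: (@cvg_invmx _ _ (nbhs x0)).
  by apply: cvgB; [apply: cvgD|]; exact: cD.
have H0 : distance_hessian G x0 x0 = 1%:M.
  apply/matrixP => i j; rewrite !mxE big1 ?subr0// => l _.
  by rewrite !mxE subrr mulr0.
have HE x i j : distance_hessian G x0 x i j =
    (i == j)%:R - \sum_l christoffel G x l i j * (x 0 l - x0 0 l).
  by rewrite !mxE; congr (_ - _); apply: eq_bigr => l _; rewrite !mxE.
have [|||c c0] := @posdef_near R _ n (distance_hessian G x0) x0.
- move=> i j; rewrite HE; under eq_fun do rewrite HE.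
  apply: (@cvgB _ _ _ (nbhs x0)); first exact: cvg_cst.
  apply: (@cvg_sumr _ _ _ (nbhs x0)) => l _.
  apply: (@cvgM _ _ (nbhs x0)); first exact: cchr.
  apply: (@cvgB _ _ _ (nbhs x0)); last exact: cvg_cst.
  exact: coord_continuous.
- by rewrite H0 trmx1.
- by rewrite H0; exact: quad1_gt0.
apply: filterS => x Hx v v0; apply: lt_le_trans (Hx v).
by rewrite mulr_gt0// quad1_gt0.
Unshelve. all: by end_near. Qed.

Lemma atlas_chart_at (R : realType) n (M : smooth_manifold R n) (p : M) :
  atlas (chart_at p).
Proof. by rewrite /chart_at; case: cid2. Qed.

Lemma chart_dom_chart_at (R : realType) n (M : smooth_manifold R n) (p : M) :
  chart_dom (chart_at p) p.
Proof. by rewrite /chart_at; case: cid2. Qed.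

Lemma continuous_quad1 (R : realType) n (x0 : 'rV[R]_n) :
  continuous (fun x : 'rV[R]_n => quad 1%:M (x - x0)).
Proof.
move=> x; rewrite /continuous_at quad1E; under eq_fun do rewrite quad1E.
apply: (@cvg_sumr _ _ _ (nbhs x)) => i _.
rewrite !mxE; under eq_fun do rewrite !mxE.
rewrite expr2; under eq_fun do rewrite expr2.
by apply: cvgM; (apply: cvgB; [exact: coord_continuous|exact: cvg_cst]).
Qed.

(** [U] is kept inside a single chart domain, so that the squared coordinate distance is defined on
    the whole image of the submanifold and attains its maximum by compactness. *)
Lemma near_no_compact_minimal (R : realType) n (M : smooth_manifold R n)
    (g : riemannian_metric M) (p0 : M) :
  exists2 U : set M, nbhs p0 U & forall S : submanifold M,
    compact [set: sub_source S] -> minimal_submanifold g S ->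
    ~ range (sub_incl S) `<=` U.
Proof.
pose d := chart_at p0; have ad : atlas d := atlas_chart_at p0.
have dp0 : chart_dom d p0 := chart_dom_chart_at p0.
pose G x := g d (chart_param d x); pose x0 := chart_coord d p0.
have x0K : chart_param d x0 = p0 by apply: chart_coordK; rewrite inE.
have nearH : \forall x \near x0, posdef (distance_hessian G x0 x).
  apply: (@distance_hessian_near _ _ _ (chart_cod d)).
  - exact: chart_cod_open.
  - exact: chart_coord_cod.
  - exact: metric_smooth.
  - by rewrite /G x0K; exact: metric_symmetric.
  - by move=> v v0; rewrite /G x0K; exact: metric_pos.
exists [set p | chart_dom d p /\
                posdef (distance_hessian G x0 (chart_coord d p))].
  apply: filterI; first exact: open_nbhs_nbhs (conj (chart_dom_open d) dp0).
  have := @chart_coord_continuous _ _ _ d p0; rewrite inE.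
  by move=> /(_ dp0)/(_ _ nearH).
move=> S cS minS rS; pose f := sub_incl S.
have df q : chart_dom d (f q) by have [] := rS (f q) (imageT _ _).
have [[cf sf] injf] := sub_immersion S.
pose F q := quad 1%:M (chart_coord d (f q) - x0).
have cF : {within [set: sub_source S], continuous F}.
  apply/continuous_subspaceT => q.
  apply: (@cvg_comp _ _ _ (chart_coord d \o f) (fun x => quad 1%:M (x - x0))
            _ (nbhs (chart_coord d (f q)))); last exact: continuous_quad1.
  apply: continuous_comp; first exact: cf.
  by apply: chart_coord_continuous; rewrite inE.
have [q _ maxq] := compact_EVT_max (sub_nonempty S) cS cF.
pose c := chart_at q; have ac : atlas c := atlas_chart_at q.
have cq : chart_dom c q := chart_dom_chart_at q.
have qK : chart_param c (chart_coord c q) = q.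
  by apply: chart_coordK; rewrite inE.
pose X := chart_coord d \o f \o chart_param c.
have XE : X (chart_coord c q) = chart_coord d (f q) by rewrite /X /= qK.
have := minS c d q ac ad cq (df q); apply/eqP.
apply: (@mean_curvature_distance_max _ _ _ _ (chart_cod c) _ _ x0).
- exact: sub_dim_gt0.
- exact: chart_cod_open.
- exact: chart_coord_cod.
(* Since the image stays in the domain of [d], the local expression [X] is smooth on all of
   [chart_cod c]. *)
- have := sf c d ac ad 2; congr Ck; apply/seteqP; split=> [u []//|u cu].
  by split=> //; exact: df.
- by move=> v cv; rewrite -/X XE; apply: (maxq (chart_param c v)); rewrite inE.
- by rewrite -/X XE chart_coordK ?inE//; exact: metric_symmetric.
- by move=> v v0; rewrite -/X XE chart_coordK ?inE//; exact: metric_pos.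
- move=> w; apply: contraNneq => wJ; apply/eqP.
  apply: (injf c d q ac ad cq (df q)).
  by rewrite linear0 -[RHS]wJ /jacobian mul_rV_lin1.
- by rewrite -/X XE; have [] := rS (f q) (imageT _ _).
Qed.

(** * Lower bounds for integrals of functions not known to be measurable *)

(** The integral of a nonnegative function is a supremum over the simple functions below it, and
    every simple function below [f] is below [g]. *)
Lemma le_integral_ge0 d (T : measurableType d) (R : realType)
    (mu : {measure set T -> \bar R}) (D : set T) (f g : T -> \bar R) :
  (forall x, D x -> 0 <= f x)%E -> (forall x, D x -> f x <= g x)%E ->
  (\int[mu]_(x in D) f x <= \int[mu]_(x in D) g x)%E.
Proof.
move=> f0 fg; have g0 x : D x -> (0 <= g x)%E.
  by move=> Dx; apply: le_trans (fg x Dx); exact: f0.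
rewrite !ge0_integralE//; apply: ereal_sup_le => _ [h hf <-].
exists h => // x.
apply: le_trans (hf x) _; rewrite !patchE; case: ifPn => //.
by rewrite inE; exact: fg.
Qed.

(* The integral of a nonnegative function is a supremum over simple functions,
   so that a measurable minorant bounds it from below even if the function
   itself (here: the speed of a curve) is not known to be measurable. *)
Definition minorized (R : realType) (w : R -> R) (a b l : R) : Prop :=
  exists h : R -> R,
    [/\ measurable_fun [set: R] h, forall t, 0 <= h t <= w t,
        forall t, ~~ (a < t < b) -> h t = 0 &
        (l%:E <= \int[lebesgue_measure]_t (h t)%:E)%E].

Lemma minorized_integral (R : realType) (w : R -> R) (l : R) :
  minorized w 0 1 l ->
  (l%:E <= \int[lebesgue_measure]_(t in `[0%R, 1%R]) (w t)%:E)%E.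
Proof.
move=> [h [mh hw h0 lh]]; apply: le_trans lh _.
have -> : (\int[lebesgue_measure]_t (h t)%:E =
    \int[lebesgue_measure]_(t in `[0%R, 1%R]) (h t)%:E)%E.
  rewrite [RHS]integral_mkcond; apply: eq_integral => t _.
  rewrite patchE; case: ifPn => //; rewrite notin_setE /= in_itv/= => /negP t01.
  by rewrite h0//; apply: contraNN t01 => /andP[/ltW-> /ltW->].
apply: le_integral_ge0 => t _; rewrite lee_fin; by have /andP[] := hw t.
Qed.

(** Each minorant vanishes off its open interval, so at every point at most one of the two is
    nonzero and their sum is still below [w]. *)
Lemma minorized_cat (R : realType) (w : R -> R) (a c b l m : R) :
  a <= c -> c <= b -> minorized w a c l -> minorized w c b m ->
  minorized w a b (l + m).
Proof.
move=> ac cb [h [mh hw h0 lh]] [k [mk kw k0 mk']].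
exists (h \+ k); split.
- exact: measurable_funD.
- move=> t; have /andP[h1 h2] := hw t; have /andP[k1 k2] := kw t.
  rewrite /= addr_ge0//=; have [tc|ct] := ltP t c.
    by rewrite k0 ?addr0// ltNge (ltW tc).
  by rewrite h0 ?add0r// [t < c]ltNge ct andbF.
- move=> t tab; rewrite /= h0 ?k0 ?addr0//; apply: contraNN tab => /andP[x y].
    by rewrite y andbT (le_lt_trans ac).
  by rewrite x (lt_le_trans y).
- rewrite EFinD.
  have -> : (\int[lebesgue_measure]_t ((h \+ k) t)%:E =
      \int[lebesgue_measure]_t ((h t)%:E + (k t)%:E))%E by [].
  rewrite ge0_integralD//; [exact: leeD| | | |].
  + by move=> t _; rewrite lee_fin; have /andP[] := hw t.
  + exact/measurable_EFinP.
  + by move=> t _; rewrite lee_fin; have /andP[] := kw t.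
  + exact/measurable_EFinP.
Qed.

Lemma minorized_le (R : realType) (w : R -> R) (a b l m : R) :
  m <= l -> minorized w a b l -> minorized w a b m.
Proof.
move=> ml [h [mh hw h0 lh]]; exists h; split=> //.
by apply: le_trans lh; rewrite lee_fin.
Qed.

Lemma minorized_partition (R : realType) (w phi : R -> R) (x0 a b : R)
    (s : seq R) :
  (forall t, 0 <= w t) -> itv_partition a b s ->
  (forall i, (i < size s)%N ->
    let u := nth x0 (a :: s) i in let v := nth x0 s i in
    minorized w u v `|phi v - phi u|) ->
  minorized w a b `|phi b - phi a|.
Proof.
move=> w0; elim: s a => [|c s IHs] a.
  move=> /itv_partition_nil <- _; exists (cst 0); split => //.
    by move=> t /=; rewrite lexx w0.
  by rewrite subrr normr0 integral0.
move=> abs hs; have cbs := itv_partition_cons abs.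
have ac : a < c by case: abs => /andP[].
have cb : c <= b := itv_partition_le cbs.
apply: (@minorized_le _ _ _ _ (`|phi c - phi a| + `|phi b - phi c|)).
  by rewrite -(subrKA (phi c)) addrC ler_normD.
apply: minorized_cat (ltW ac) cb _ _; first exact: (hs 0).
by apply: IHs => // i si; exact: (hs i.+1).
Qed.

(** The minorant is the absolute value of [dphi], cut off outside the open interval; by the
    fundamental theorem of calculus its integral is at least the increment of [phi]. At the
    endpoints [dphi] and [w] are not compared, since a piecewise smooth curve may have a corner
    there, but two points do not affect the integral. *)
Lemma minorized_ftc (R : realType) (w phi dphi : R -> R) (a b : R) :
  a < b -> (forall t, 0 <= w t) ->
  (forall t, a <= t <= b -> is_derive t (1 : R) phi (dphi t)) ->
  (forall t, a <= t <= b -> {for t, continuous dphi}) ->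
  (forall t, a < t < b -> `|dphi t| <= w t) ->
  minorized w a b `|phi b - phi a|.
Proof.
move=> ab w0 dphiE cdphi dphiw.
have wc : {within `[a, b], continuous dphi}.
  apply: continuous_in_subspaceT => t; rewrite inE /= in_itv/=.
  exact: cdphi.
have cphi t : a <= t <= b -> {for t, continuous phi}.
  move=> tab; apply: differentiable_continuous; apply/derivable1_diffP.
  by case: (dphiE t tab).
have mI : measurable_fun `[a, b] (EFin \o dphi).
  by apply/measurable_EFinP; exact: subspace_continuous_measurable_fun wc.
have mI' : measurable_fun `[a, b] (fun t => `|(dphi t)%:E|%E).
  exact: measurableT_comp.
have ftc : (\int[lebesgue_measure]_(t in `[a, b]) (dphi t)%:E =
    (phi b)%:E - (phi a)%:E)%E.
  apply: continuous_FTC2 => //; first split.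
  - move=> t; rewrite in_itv/= => /andP[/ltW at_ /ltW tb].
    by have [] := dphiE t; rewrite ?at_.
  - by apply: cvg_at_right_filter; apply: cphi; rewrite lexx ltW.
  - by apply: cvg_at_left_filter; apply: cphi; rewrite lexx ltW.
  - move=> t; rewrite in_itv/= => /andP[/ltW at_ /ltW tb].
    by have [|_ <-] := dphiE t; rewrite ?at_// derive1E.
exists ((fun t => `|dphi t|) \_ `]a, b[); split.
- apply/(measurable_restrict _ _ _).1 => //; rewrite setTI.
  apply: (@measurable_funS _ _ _ _ `[a, b]) => //.
    by apply: subset_itv_oo_cc.
  by apply: measurableT_comp => //; exact/measurable_EFinP.
- move=> t; rewrite patchE; case: ifPn => [|_]; last by rewrite lexx w0.
  by rewrite inE /= in_itv/= => /dphiw ->; rewrite normr_ge0.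
- by move=> t; rewrite patchE mem_setE in_itv/= => /negbTE ->.
- rewrite -[`|_|%:E]/(`|(phi b - phi a)%:E|%E) EFinB -ftc.
  apply: le_trans (le_abse_integral _ _ _) _ => //.
  rewrite -integral_itv_obnd_cbnd; last first.
    by apply: measurable_funS mI' => //; exact: subset_itv_oc_cc.
  rewrite -integral_itv_bndo_bndc; last first.
    by apply: measurable_funS mI' => //; exact: subset_itv_oo_cc.
  rewrite integral_mkcond; apply: le_integral_ge0 => t _; rewrite !patchE.
    by case: ifPn.
  by case: ifPn.
Qed.

(** * Speed of curves, and functions whose gradient has norm at most 1 *)

Lemma speed_near_eq (R : realType) n (M : smooth_manifold R n)
    (g : riemannian_metric M) (gam eta : R -> M) (t : R) :
  (\forall s \near t, gam s = eta s) -> speed g gam t = speed g eta t.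
Proof.
move=> ge; rewrite /speed (nbhs_singleton ge) !derive1E.
by rewrite (@near_eq_derive _ _ _ _ (chart_coord (chart_at (eta t)) \o eta))//;
   apply: filterS ge => s /= ->.
Qed.

(** By the chain rule a change of chart multiplies the velocity by the Jacobian of the transition
    map, and [metric_change] compensates for it. The chart selected inside [speed] can thus be
    replaced by any chart around the point. *)
Lemma speed_chart (R : realType) n (M : smooth_manifold R n)
    (g : riemannian_metric M) (eta : R -> M) (t : R) (d : chart R n M) :
  atlas d -> chart_dom d (eta t) -> {for t, continuous eta} ->
  differentiable (chart_coord d \o eta) t ->
  speed g eta t = Num.sqrt (quad (g d (eta t)) ('D_1 (chart_coord d \o eta) t)).
Proof.
move=> ad det ceta dx; pose c := chart_at (eta t).
have ac : atlas c := atlas_chart_at _.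
have cet : chart_dom c (eta t) := chart_dom_chart_at _.
have dk : chart_param d (chart_coord d (eta t)) = eta t.
  by apply: chart_coordK; rewrite inE.
pose Phi := chart_coord c \o chart_param d.
have dPhi : differentiable Phi (chart_coord d (eta t)).
  have [+ _] := atlas_compatible ad ac 1; apply; split.
    exact: chart_coord_cod.
  by rewrite dk.
rewrite /speed -/c derive1E.
have -> : 'D_1 (chart_coord c \o eta) t =
    'D_1 (Phi \o (chart_coord d \o eta)) t.
  apply: near_eq_derive.
  have : \forall s \near t, chart_dom d (eta s).
    apply: ceta; apply: open_nbhs_nbhs; split=> //; exact: chart_dom_open.
  by apply: filterS => s ds; rewrite /Phi /= chart_coordK// inE.
rewrite deriveE; last exact: differentiable_comp.
rewrite diff_comp// [(_ \o _) 1]/= -[X in 'd Phi _ X]deriveE//.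
have JE w : 'd Phi (chart_coord d (eta t)) w =
    w *m 'J Phi (chart_coord d (eta t)) by rewrite /jacobian mul_rV_lin1.
by rewrite !JE (metric_change g ad ac det cet) quad_mul.
Qed.

(* The square makes the positive part C^1, which is all the regularity that
   the cut-off function [chart_bump] needs. *)
Lemma is_derive_sqr_max0 (R : realType) (s : R) :
  is_derive s (1 : R) (fun s => Num.max 0 s ^+ 2) (2 * Num.max 0 s).
Proof.
have H : h^-1 *: (Num.max 0 (h *: 1 + s) ^+ 2 - Num.max 0 s ^+ 2)
    @[h --> (0 : R)^'] --> 2 * Num.max 0 s.
  apply/cvgrPdist_le => e e0; near=> h.
  have h0 : h != 0 by near: h; exact: nbhs_dnbhs_neq.
  have he : `|h| <= e by near: h; exact: dnbhs0_le.
  (* It suffices that the error is at most [|h|]. After multiplication by [|h|] this bounds the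
     remainder by $h^2$, a polynomial inequality in each of the four sign cases of [s] and
     [h + s]. *)
  apply: le_trans he.
  rewrite -(ler_pM2l (x := `|h|)) ?normr_gt0// -normrM -normrM -expr2.
  rewrite (_ : h * _ = 2 * Num.max 0 s * h -
      (Num.max 0 (h + s) ^+ 2 - Num.max 0 s ^+ 2)); last first.
    by rewrite [h *: 1]mulr1 -[_ *: _]/(h^-1 * _); field.
  rewrite [leRHS]ger0_norm ?sqr_ge0// ler_norml.
  by case: (leP 0 s) => s0; case: (leP 0 (h + s)) => hs; apply/andP; split; nra.
apply: DeriveDef; first by apply/cvg_ex; exists (2 * Num.max 0 s).
exact/cvg_lim.
Unshelve. all: by end_near. Qed.

(* The weak form of |grad F| <= 1 that is tested along smooth curves. *)
Definition subspeed (R : realType) n (M : smooth_manifold R n)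
    (g : riemannian_metric M) (F : M -> R) : Prop :=
  forall (O : set R) (eta : R -> M), open O -> {in O, continuous eta} ->
  (forall d : chart R n M, atlas d ->
     smooth_on [set t | O t /\ chart_dom d (eta t)] (chart_coord d \o eta)) ->
  exists dphi : R -> R, forall t, O t ->
    [/\ is_derive t (1 : R) (F \o eta) (dphi t), {for t, continuous dphi} &
        `|dphi t| <= speed g eta t].

(** On each smooth piece the increment of [F] is the integral of a continuous derivative dominated
    by the speed; the pieces are then combined by [minorized_partition]. *)
Lemma subspeed_curve_length (R : realType) n (M : smooth_manifold R n)
    (g : riemannian_metric M) (F : M -> R) (gam : R -> M) :
  subspeed g F -> piecewise_smooth gam ->
  (`|F (gam 1%R) - F (gam 0%R)|%:E <= curve_length g gam)%E.
Proof.
move=> subF [s part pieces]; apply: minorized_integral.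
apply: (@minorized_partition _ _ (F \o gam) 1 0 1 s) => //.
  by move=> t; exact: sqrtr_ge0.
move=> i si u v; have uv : u < v.
  by have [/(pathP 1)/(_ i si)] := part.
have [D [eta [oO uvO ceta seta gameta]]] := pieces i si.
have [dphi dphiP] := subF D eta oO ceta seta.
have Ot t : u <= t <= v -> D t by move=> uvt; apply: uvO; rewrite /= in_itv.
have gE t : u <= t <= v -> gam t = eta t.
  by move=> uvt; apply: gameta; rewrite inE /= in_itv.
rewrite /= !gE ?lexx ?ltW//.
apply: (@minorized_ftc _ _ (F \o eta) dphi) => //.
- by move=> t; exact: sqrtr_ge0.
- by move=> t /Ot/dphiP[].
- by move=> t /Ot/dphiP[].
- move=> t /andP[ut tv].
  have /Ot/dphiP[_ _] : u <= t <= v by rewrite !ltW.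
  (* Strictly inside a piece, [gam] agrees with [eta] on a neighbourhood of [t], so the speeds
     coincide; at a breakpoint they may differ. *)
  move=> /le_trans; apply; rewrite (@speed_near_eq _ _ _ g gam eta)//.
  near=> r; apply: gE; apply/andP; split; apply/ltW; near: r.
    exact: (cvgr_gt t cvg_id).
  exact: (cvgr_lt t cvg_id).
Unshelve. all: by end_near. Qed.

(** * Bump functions supported in a coordinate ball *)

Lemma coord_le_sqrt (R : rcfType) n (v : 'rV[R]_n) (c q : R) l :
  0 < c -> c * quad 1%:M v <= q -> `|v 0 l| <= Num.sqrt q / Num.sqrt c.
Proof.
move=> c0 vq; rewrite ler_pdivlMr ?sqrtr_gt0// -sqrtr_sqr -sqrtrM ?sqr_ge0//.
apply: ler_wsqrtr; rewrite mulrC; apply: le_trans vq.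
by rewrite ler_pM2l//; exact: sqr_le_quad1.
Qed.

Lemma coord_le_quad1 (R : realType) n (v : 'rV[R]_n) (r : R) l :
  0 <= r -> quad 1%:M v <= r ^+ 2 -> `|v 0 l| <= r.
Proof.
move=> r0 vr; rewrite -(ler_pXn2r (n := 2)) ?nnegrE// real_normK ?num_real//.
exact: le_trans (sqr_le_quad1 v l) vr.
Qed.

Lemma norm_le_quad1 (R : realType) n (v : 'rV[R]_n) (r : R) :
  0 <= r -> quad 1%:M v <= r ^+ 2 -> `|v| <= r.
Proof.
move=> r0 vr; rewrite [leLHS]/Num.Def.normr/= mx_normrE.
by apply: bigmax_le => // -[i j] _ /=; rewrite ord1; exact: coord_le_quad1.
Qed.

Lemma compact_quad1_le (R : realType) n (x0 : 'rV[R]_n) (r : R) :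
  0 <= r -> compact [set x | quad 1%:M (x - x0) <= r ^+ 2].
Proof.
move=> r0; apply: bounded_closed_compact.
  exists (`|x0| + r); split; first exact: num_real.
  move=> m rm x /= /(norm_le_quad1 r0) xr; apply/ltW; apply: le_lt_trans rm.
  by rewrite -[x](subrK x0) addrC (le_trans (ler_normD _ _))// lerD2l.
have := @preimage_closed _ _ (fun x : 'rV[R]_n => quad 1%:M (x - x0))
  [set y : R | y <= r ^+ 2].
apply; first by move=> x _; exact: continuous_quad1.
exact: closed_le.
Qed.

(** The coordinate ball is the image of a compact set under [chart_param], hence compact, hence
    closed in the Hausdorff space [M]. This allows a bump function to be extended by zero outside
    the chart. *)
Lemma closed_chart_quad1_le (R : realType) n (M : smooth_manifold R n)
    (d : chart R n M) (x0 : 'rV[R]_n) (r : R) : 0 <= r ->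
  (forall x, quad 1%:M (x - x0) <= r ^+ 2 -> chart_cod d x) ->
  closed [set p | chart_dom d p /\ quad 1%:M (chart_coord d p - x0) <= r ^+ 2].
Proof.
move=> r0 cod_r.
have -> :
    [set p | chart_dom d p /\ quad 1%:M (chart_coord d p - x0) <= r ^+ 2] =
    chart_param d @` [set x | quad 1%:M (x - x0) <= r ^+ 2].
  apply/seteqP; split=> [p [dp pr]|_ [x xr <-]].
    by exists (chart_coord d p) => //; apply: chart_coordK; rewrite inE.
  split; first exact/chart_param_dom/cod_r.
  by rewrite chart_paramK// inE; exact: cod_r.
apply: compact_closed; first exact: carrier_hausdorff.
apply: continuous_compact; last exact: compact_quad1_le.
apply: continuous_in_subspaceT => x; rewrite inE => /cod_r dx.
by apply: chart_param_continuous; rewrite inE.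
Qed.

Lemma near_eq_continuous (T U : topologicalType) (f h : T -> U) (t : T) :
  (\forall s \near t, f s = h s) -> {for t, continuous f} ->
  {for t, continuous h}.
Proof.
move=> fh cf; suff : h u @[u --> t] --> h t by [].
by rewrite -(nbhs_singleton fh); apply: cvg_trans cf; exact: near_eq_cvg.
Qed.

(** Factor that brings the gradient of the bump below 1 when the metric is at least [c] times the
    Euclidean one on the ball of radius [r]. The [+ 1] keeps the denominator positive even when [n]
    is 0. *)
Definition bump_scale (R : realType) (n : nat) (r c : R) : R :=
  Num.sqrt c / (4 * r ^+ 2 * (n%:R * r) + 1).

(** Here [y] is the position relative to the centre, [v] the velocity and [q] its squared length for
    the metric. Outside the ball the positive part vanishes; inside, the coordinates of [y] are at
    most [r] and those of [v] at most [Num.sqrt q / Num.sqrt c] in absolute value. *)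
Lemma bump_derive_le (R : realType) n (y v : 'rV[R]_n) (r c q : R) :
  0 < r -> 0 < c -> (quad 1%:M y <= r ^+ 2 -> c * quad 1%:M v <= q) ->
  `|bump_scale n r c * (2 * Num.max 0 (r ^+ 2 - quad 1%:M y) *
      - (2 * \sum_l y 0 l * v 0 l))| <= Num.sqrt q.
Proof.
move=> r0 c0 vq; rewrite /bump_scale.
set C := 4 * r ^+ 2 * (n%:R * r) + 1; set k := _ / C; set s := Num.max 0 _.
have C0 : 0 < C by rewrite ltr_wpDl// !mulr_ge0// ltW.
have sc0 : 0 < Num.sqrt c by rewrite sqrtr_gt0.
have k0 : 0 < k by rewrite divr_gt0.
have [yr|ry] := leP (quad 1%:M y) (r ^+ 2); last first.
  by rewrite /s max_l ?mulr0 ?mul0r ?mulr0 ?normr0 ?sqrtr_ge0// subr_le0 ltW.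
have {}vq := vq yr.
have vl l : `|v 0 l| <= Num.sqrt q / Num.sqrt c by exact: coord_le_sqrt.
have yl l : `|y 0 l| <= r.
  exact: coord_le_quad1 (ltW r0) yr.
have sumle : `|\sum_l y 0 l * v 0 l| <= n%:R * (r * (Num.sqrt q / Num.sqrt c)).
  apply: le_trans (ler_norm_sum _ _ _) _.
  rewrite mulr_natl -[n in leRHS]card_ord -sumr_const; apply: ler_sum => l _.
  by rewrite normrM ler_pM.
have s_ge0 : 0 <= s by rewrite le_max lexx.
have sr : s <= r ^+ 2.
  by rewrite ge_max sqr_ge0/= lerBlDr lerDl quad1_ge0.
rewrite normrM (gtr0_norm k0) normrM normrN normrM normrM.
rewrite (ger0_norm s_ge0) normr_nat.
apply: (@le_trans _ _
    (k * (2 * r ^+ 2 * (2 * (n%:R * (r * (Num.sqrt q / Num.sqrt c))))))).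
  by rewrite ler_pM2l// ler_pM ?mulr_ge0// ?ler_pM2l.
have -> : k * (2 * r ^+ 2 * (2 * (n%:R * (r * (Num.sqrt q / Num.sqrt c))))) =
    (C - 1) / C * Num.sqrt q.
  rewrite /k; have -> : C - 1 = 4 * r ^+ 2 * (n%:R * r) by rewrite addrK.
  by field; rewrite !gt_eqF.
rewrite ler_piMl ?sqrtr_ge0// ler_pdivrMr// mul1r.
by rewrite lerBlDr lerDl.
Qed.

(** The test on the domain is what extends the bump by zero, as [chart_coord] is arbitrary outside
    [chart_dom]. *)
Definition chart_bump (R : realType) n (M : smooth_manifold R n)
    (d : chart R n M) (x0 : 'rV[R]_n) (r k : R) (p : M) : R :=
  if `[< chart_dom d p >] then
    k * Num.max 0 (r ^+ 2 - quad 1%:M (chart_coord d p - x0)) ^+ 2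
  else 0.

Lemma chart_bump_subspeed (R : realType) n (M : smooth_manifold R n)
    (g : riemannian_metric M) (d : chart R n M) (x0 : 'rV[R]_n) (r c : R) :
  atlas d -> 0 < r -> 0 < c ->
  (forall x, quad 1%:M (x - x0) <= r ^+ 2 -> chart_cod d x) ->
  (forall p, chart_dom d p -> quad 1%:M (chart_coord d p - x0) <= r ^+ 2 ->
     forall v, c * quad 1%:M v <= quad (g d p) v) ->
  exists2 k : R, 0 < k & subspeed g (chart_bump d x0 r k).
Proof.
move=> ad r0 c0 cod_r met.
have k0 : 0 < bump_scale n r c.
  by rewrite divr_gt0 ?sqrtr_gt0// ltr_wpDl// !mulr_ge0// ltW.
exists (bump_scale n r c) => //; set k := bump_scale n r c in k0 *.
(* K is closed, so chart_bump vanishes near any point outside the chart. *)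
have Kclosed := closed_chart_quad1_le (ltW r0) cod_r.
set K := [set p | _] in Kclosed.
move=> D eta oD ceta seta.
pose x := chart_coord d \o eta.
pose s t := Num.max 0 (r ^+ 2 - quad 1%:M (x t - x0)).
pose ds t := - (2 * \sum_l (x t 0 l - x0 0 l) * ('D_1 x t) 0 l).
(* The derivative prescribed by the chain rule inside the chart, and zero elsewhere. *)
pose dphi t := if `[< chart_dom d (eta t) >] then k * (2 * s t * ds t) else 0.
exists dphi => t Dt.
have ct : {for t, continuous eta} by apply: ceta; rewrite inE.
have [dt|ndt] := pselect (chart_dom d (eta t)); last first.
  have nearNK : \forall u \near t, ~ K (eta u).
    apply: (ct (~` K)); apply: open_nbhs_nbhs; split; last by case.
    exact: closed_openC.
  have s0 u : ~ K (eta u) -> chart_dom d (eta u) -> s u = 0.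
    move=> nK du; apply/max_idPl; rewrite subr_le0 ltW// ltNge.
    by apply/negP => ur; apply: nK.
  have F0 : \forall u \near t, cst 0 u = (chart_bump d x0 r k \o eta) u.
    near=> u; rewrite /chart_bump /=; case: asboolP => // du.
    by rewrite -/(x u) -/(s u) s0 ?expr0n ?mulr0//; near: u.
  have d0 : \forall u \near t, cst 0 u = dphi u.
    near=> u; rewrite /dphi /=; case: asboolP => // du.
    by rewrite s0 ?mulr0 ?mul0r ?mulr0//; near: u.
  split.
  - have -> : dphi t = 0 := esym (nbhs_singleton d0).
    exact: near_eq_is_derive F0 (is_derive_cst _ _ _).
  - by apply: near_eq_continuous d0 _; exact: cvg_cst.
  - by rewrite -(nbhs_singleton d0) /= normr0; exact: sqrtr_ge0.
have [dx /(_ 1) cdx] := seta d ad 1.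
have xt : differentiable x t by apply: dx.
have neardom : \forall u \near t, chart_dom d (eta u).
  by apply: ct; apply: open_nbhs_nbhs; split=> //; exact: chart_dom_open.
have FE : \forall u \near t,
    (fun u => k * s u ^+ 2) u = (chart_bump d x0 r k \o eta) u.
  by apply: filterS neardom => u du; rewrite /chart_bump /= asboolT.
have dE : \forall u \near t, (fun u => k * (2 * s u * ds u)) u = dphi u.
  by apply: filterS neardom => u du; rewrite /dphi asboolT.
have cx : {for t, continuous x} by exact: differentiable_continuous.
have cdxt : {for t, continuous ('D_1 x)} by apply: cdx; rewrite inE.
have coordc (h : R -> 'rV[R]_n) l : {for t, continuous h} ->
    h u 0 l @[u --> t] --> h t 0 l.
  move=> ch; apply: (@cvg_comp _ _ _ h (fun A => A 0 l) _ (nbhs (h t))) => //.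
  exact: coord_continuous.
split.
- rewrite -(nbhs_singleton dE); apply: near_eq_is_derive FE _.
  apply: is_deriveZ.
  apply: (@is_derive1_comp _ (fun y => Num.max 0 y ^+ 2)
            (fun u => r ^+ 2 - quad 1%:M (x u - x0))).
    exact: is_derive_sqr_max0.
  rewrite /ds -[X in is_derive _ _ _ X]add0r; apply: is_deriveB.
  by apply: is_derive_quad1; apply: derivableP; exact/derivable1_diffP.
- apply: near_eq_continuous dE _.
  apply: cvgM; first exact: cvg_cst.
  apply: cvgM.
    apply: cvgM; first exact: cvg_cst.
    (* Continuity of the positive part, through $\max(a,b) = (a+b+|a-b|)/2$. *)
    rewrite /s; under eq_fun do rewrite maxr_absE; rewrite maxr_absE.
    apply: cvgM; last exact: cvg_cst.
    have cs : r ^+ 2 - quad 1%:M (x u - x0) @[u --> t] -->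
        r ^+ 2 - quad 1%:M (x t - x0).
      apply: cvgB; first exact: cvg_cst.
      apply: (@cvg_comp _ _ _ x (fun y => quad 1%:M (y - x0)) _
        (nbhs (x t))) => //.
      exact: continuous_quad1.
    apply: cvgD; first by apply: cvgD => //; exact: cvg_cst.
    by apply: cvg_norm; apply: cvgB => //; exact: cvg_cst.
  apply: cvgN; apply: cvgM; first exact: cvg_cst.
  apply: cvg_sumr => l _; apply: cvgM; last exact: coordc.
  by apply: cvgB; [exact: coordc|exact: cvg_cst].
- rewrite -(nbhs_singleton dE) (speed_chart g ad dt ct xt) /ds /s.
  have -> : \sum_l (x t 0 l - x0 0 l) * ('D_1 x t) 0 l =
      \sum_l (x t - x0) 0 l * ('D_1 x t) 0 l.
    by apply: eq_bigr => l _; rewrite !mxE.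
  by apply: bump_derive_le => // xr; exact: met.
Unshelve. all: by end_near. Qed.

(** * Small geodesic balls inside a neighbourhood, and the conclusion *)

Lemma subspeed_bump_exists (R : realType) n (M : smooth_manifold R n)
    (g : riemannian_metric M) (p0 : M) (U : set M) : nbhs p0 U ->
  exists F : M -> R, [/\ subspeed g F, 0 < F p0, {for p0, continuous F} &
    forall q, ~ U q -> F q = 0].
Proof.
move=> nU; pose d := chart_at p0; have ad : atlas d := atlas_chart_at p0.
have dp0 : chart_dom d p0 := chart_dom_chart_at p0.
pose x0 := chart_coord d p0.
have cx0 : chart_cod d x0 by exact: chart_coord_cod.
have x0K : chart_param d x0 = p0 by apply: chart_coordK; rewrite inE.
have ccoord : {for p0, continuous (chart_coord d)}.
  by apply: chart_coord_continuous; rewrite inE.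
have cparam : {for x0, continuous (chart_param d)}.
  by apply: chart_param_continuous; rewrite inE.
pose G x := g d (chart_param d x).
have [|||c c0 Gc] := @posdef_near R _ n G x0.
- move=> i j; apply: (@cvg_comp _ _ _ G (fun A => A i j) _ (nbhs (G x0))).
    by have := metric_smooth g ad 0; apply; rewrite inE.
  exact: coord_continuous.
- by rewrite /G x0K; exact: metric_symmetric.
- by move=> v v0; rewrite /G x0K; exact: metric_pos.
have [e /= e0 He] : exists2 e : R, 0 < e & forall x, `|x - x0| < e ->
    [/\ chart_cod d x, U (chart_param d x) &
        forall v, c * quad 1%:M v <= quad (G x) v].
  have : \forall x \near x0, [/\ chart_cod d x, U (chart_param d x) &
      forall v, c * quad 1%:M v <= quad (G x) v].
    have H1 : \forall x \near x0, chart_cod d x.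
      by apply: open_nbhs_nbhs; split=> //; exact: chart_cod_open.
    have H2 : \forall x \near x0, U (chart_param d x).
      by apply: cparam; rewrite x0K.
    by apply: filterS3 H1 H2 Gc.
  move=> /nbhs_ballP[e /= e0 He]; exists e => // x xe; apply: He.
  by rewrite -ball_normE /ball_/= distrC.
(* Halving puts the closed Euclidean ball of radius [r] inside the open ball of radius [e] for the
   maximum norm, where the properties in [He] hold. *)
pose r := e / 2; have r0 : 0 < r by rewrite divr_gt0.
have Hr x : quad 1%:M (x - x0) <= r ^+ 2 ->
    [/\ chart_cod d x, U (chart_param d x) &
        forall v, c * quad 1%:M v <= quad (G x) v].
  move=> /(norm_le_quad1 (ltW r0)) xr; apply: He; apply: le_lt_trans xr _.
  by rewrite ltr_pdivrMr// ltr_pMr// ltr1n.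
have [||k k0 subF] := @chart_bump_subspeed _ _ _ g d x0 r c ad r0 c0.
- by move=> x /Hr[].
- by move=> p dp /Hr[_ _]; rewrite /G chart_coordK// inE.
exists (chart_bump d x0 r k); split=> //.
- rewrite /chart_bump asboolT// -/x0 subrr quad1E.
  rewrite big1 => [|i _]; last by rewrite mxE expr0n.
  by rewrite subr0 max_r ?sqr_ge0// mulr_gt0// !exprn_gt0.
- have nd : \forall p \near p0, chart_dom d p.
    by apply: open_nbhs_nbhs; split=> //; exact: chart_dom_open.
  apply: (@near_eq_continuous _ _
    (fun p => k * Num.max 0 (r ^+ 2 - quad 1%:M (chart_coord d p - x0)) ^+ 2)).
    by apply: filterS nd => p dp; rewrite /chart_bump asboolT.
  apply: cvgM; first exact: cvg_cst.
  apply: (@cvg_comp _ _ _ (fun p => r ^+ 2 - quad 1%:M (chart_coord d p - x0))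
    (fun y => Num.max 0 y ^+ 2) _ (nbhs (r ^+ 2 - quad 1%:M (x0 - x0)))).
    apply: cvgB; first exact: cvg_cst.
    apply: (@cvg_comp _ _ _ (chart_coord d) (fun y => quad 1%:M (y - x0)) _
      (nbhs x0)) => //.
    exact: continuous_quad1.
  have cmax (y : R) : {for y, continuous (fun y : R => Num.max 0 y ^+ 2)}.
    apply: differentiable_continuous; apply/derivable1_diffP.
    by case: (is_derive_sqr_max0 y).
  exact: cmax.
- move=> q nUq; rewrite /chart_bump; case: asboolP => // dq.
  have [/Hr[_ + _]|rq] := leP (quad 1%:M (chart_coord d q - x0)) (r ^+ 2).
    by rewrite chart_coordK ?inE.
  by rewrite max_l ?expr0n ?mulr0// subr_le0 ltW.
Qed.

(** A curve from [p] to a point outside [U] has length at least [F p], as [F] vanishes at its end.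
    The threshold [F p0 / 2] lies below [F p] for [p] near [p0] and above every small radius.
    Stating this jointly in centre and radius prepares the use of compactness. *)
Lemma near_geodesic_ball_sub (R : realType) n (M : smooth_manifold R n)
    (g : riemannian_metric M) (p0 : M) (U : set M) : nbhs p0 U ->
  \forall p \near p0 & e \near (0 : R)^'+, geodesic_ball g p e `<=` U.
Proof.
move=> /(subspeed_bump_exists g)[F [subF F0 cF FU]].
have F2 : 0 < F p0 / 2 by rewrite divr_gt0.
exists ([set p | F p0 / 2 < F p], [set e | e < F p0 / 2]).
  split=> /=.
    apply: (cvgr_gt (F p0) cF).
    by rewrite ltr_pdivrMr// ltr_pMr// ltr1n.
  exact: nbhs_right_lt.
move=> [p e] /= [Fp eF] q /ereal_inf_lt[_ [gam [gps gp gq] <-] gl].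
apply: contrapT => nUq.
have := le_lt_trans (subspeed_curve_length subF gps) gl.
rewrite lte_fin gp gq FU// sub0r normrN ltNge => /negP; apply.
by rewrite (le_trans (ltW eF))// (le_trans (ltW Fp))// ler_norm.
Qed.

Theorem theorem31 (R : realType) (n : nat) (M : smooth_manifold R n)
    (g : riemannian_metric M) (compM : compact [set: M]) :
  exists2 delta : R, 0 < delta &
    forall p : M, ~ exists S : submanifold M,
      [/\ compact [set: sub_source S],
          minimal_submanifold g S &
          range (sub_incl S) `<=` geodesic_ball g p delta].
Proof.
pose P (e : R) (p : M) := ~ exists S : submanifold M,
  [/\ compact [set: sub_source S], minimal_submanifold g S &
      range (sub_incl S) `<=` geodesic_ball g p e].
have nearP : \forall e \near (0 : R)^'+, [set: M] `<=` P e.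
  (* Near-covering form of compactness: a property that holds, around each [p0], jointly for nearby
     points and small radii holds on all of [M] for small radii. *)
  apply: (compact_near_coveringP _).1 compM _ _ _ _ _ => p0 _.
  have [U nU noS] := near_no_compact_minimal g p0.
  apply: filterS (near_geodesic_ball_sub g nU) => -[p e] /= ballU.
  move=> [S [cS mS Sball]]; apply: noS cS mS _.
  exact: subset_trans ballU.
near (0 : R)^'+ => e; exists e; first by near: e; exact: nbhs_right_gt.
have Pe : [set: M] `<=` P e by near: e.
by move=> p; exact: Pe.
Unshelve. all: by end_near. Qed.
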